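(* Let $G$ be a finite group such that $(G,Z(G))$ is a Camina pair. If $G$ is a $p$-group ($p$ a prime) and the exponent of $G/Z(G)$ is not $p$, then $|Z(G)| < |G:Z(G)|^{1/2}$.
   Context: A pair $(G,N)$ is a Camina pair if $N$ is a normal subgroup of the finite group $G$ with $1 < N < G$ (i.e. $N$ is nontrivial and proper) and every element $g \in G \setminus N$ is conjugate in $G$ to every element of the coset $gN$. Here $Z(G)$ is the center of $G$. *)

(* Defs.v *)
From mathcomp Require Import all_boot all_order all_fingroup all_algebra.
From mathcomp Require Import all_solvable all_field.

Set Implicit Arguments.
Unset Strict Implicit.
Unset Printing Implicit Defensive.

Import GroupScope.

(* [g *: N] is the left coset gN and [g ^: G] the G-conjugacy class of g, so
   the last clause says that g is G-conjugate to every element of gN. *)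
Definition camina_pair (gT : finGroupType) (G N : {group gT}) : Prop :=
  [/\ N <| G,
      N :!=: 1,
      N \proper G
    & forall g : gT, g \in G :\: N ->
        forall h : gT, h \in g *: N -> h \in g ^: G].

(* Main.v *)
Require Import Defs.
From mathcomp Require Import all_boot all_order all_fingroup all_algebra.
From mathcomp Require Import all_solvable all_field.

(** The map x |-> [g, x] has image containing Z = Z(G) for g outside Z, so a
    subgroup of G containing every x with [g, x] in Z has order at least
    |Z| |C_G(g)|. Since Z has exponent p, such an x centralises g^p. If g^p is
    not in Z, this yields |Z| |C_G(g)| <= |C_G(g^p)| and
    |Z| |C_G(g^p)| <= |G|; finally Z < C_G(g) because g is not in Z. *)

Set Implicit Arguments.
Unset Strict Implicit.
Unset Printing Implicit Defensive.

Import GroupScope GRing.Theory Num.Theory.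

Lemma camina_pair_commg (gT : finGroupType) (G N : {group gT}) (g z : gT) :
  camina_pair G N -> g \in G :\: N -> z \in N ->
  exists2 x, x \in G & [~ g, x] = z.
Proof.
case=> _ _ _ camN gGN zN.
have /imsetP[x xG gz] : g * z \in g ^: G by apply: camN; rewrite // mem_lcoset mulKg.
by exists x => //; rewrite commgEl -gz mulKg.
Qed.

(** [A] contains ['C_G[g]], so the index of this centraliser in [A] is the size of the [A]-class of
    g. That class covers the coset gN: each z in N is some [g, x], and such an x lies in [A]. *)
Lemma camina_pair_cent_bound (gT : finGroupType) (G N A : {group gT}) (g : gT) :
  camina_pair G N -> g \in G :\: N -> A \subset G ->
  (forall x, x \in G -> [~ g, x] \in N -> x \in A) ->
  #|N| * #|'C_G[g]| <= #|A|.
Proof.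
move=> camGN gGN sAG sDA.
have sCA : 'C_G[g] \subset A.
  apply/subsetP=> x /setIP[xG /cent1P cgx]; apply: sDA => //.
  by have /commgP/eqP-> : commute g x.
have eqC : 'C_A[g] = 'C_G[g].
  by apply/eqP; rewrite eqEsubset setSI // subsetI sCA subsetIr.
rewrite -(Lagrange sCA) mulnC leq_mul2l; apply/orP; right.
have -> : #|A : 'C_G[g]| = #|g ^: A| by rewrite -eqC index_cent1.
rewrite -(card_lcoset N g); apply/subset_leq_card/subsetP.
move=> _ /lcosetP[z zN ->].
have [x xG gxz] := camina_pair_commg camGN gGN zN.
by apply/imsetP; exists x; rewrite ?sDA ?gxz // -gxz commgEl mulKVg.
Qed.

(** Lift to some g in G an element of order p in the center of G/Z. Each z in Z is some [g, x]; as
    it is central, z^p = [g^p, x], which is trivial because g^p lies in Z. *)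
Lemma camina_pair_center_expg (gT : finGroupType) (G : {group gT}) (p : nat) :
  camina_pair G 'Z(G)%G -> prime p -> p.-group G ->
  forall z, z \in 'Z(G) -> z ^+ p = 1.
Proof.
move=> camG p_pr pG z zZ; have [nZG _ /proper_subn nsGZ _] := camG.
have nZ := normal_norm nZG.
have ntZq : 'Z(G / 'Z(G)) != 1.
  by rewrite (center_nil_eq1 (pgroup_nil (quotient_pgroup _ pG))) -subG1 quotient_sub1.
have pZq : p.-group 'Z(G / 'Z(G)) by rewrite (pgroupS (center_sub _)) ?quotient_pgroup.
have [_ p_dv _] := pgroup_pdiv pZq ntZq.
have [u /setIP[uG /centP cu] ou] := Cauchy p_pr p_dv.
have /morphimP[g gN gG /= def_u] := uG.
have g_nZ : g \in G :\: 'Z(G).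
  rewrite inE gG andbT; apply: contraL (prime_gt1 p_pr) => gZ.
  by rewrite -ou def_u coset_id ?order1.
have gpZ : g ^+ p \in 'Z(G).
  apply: coset_idr; first exact: groupX.
  by rewrite morphX //= -def_u -ou expg_order.
have [x xG <-] := camina_pair_commg camG g_nZ zZ.
have xN : x \in 'N('Z(G)) by apply: (subsetP nZ).
have cgx : [~ g, x] \in 'Z(G).
  apply: coset_idr; first by rewrite groupR.
  rewrite morphR //= -def_u; apply/eqP/commgP.
  by apply: cu; apply: mem_quotient.
have [_ /centP cR] := setIP cgx; have [_ /centP cgp] := setIP gpZ.
rewrite -commXg; last exact/commute_sym/cR.
by apply/eqP/commgP/cgp.
Qed.

Theorem theorem5 (gT : finGroupType) (G : {group gT}) (p : nat) :
  camina_pair G 'Z(G)%G ->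
  prime p ->
  p.-group G ->
  exponent (G / 'Z(G)) <> p ->
  (#|'Z(G)|%:R < sqrtC (#|G : 'Z(G)|%:R) :> algC)%R.
Proof.
move=> camG p_pr pG exp_neq; have [nZG _ /proper_subn nsGZ _] := camG.
have nZ := normal_norm nZG; have sZG := normal_sub nZG.
(* If all p-th powers were central, the exponent of G/Z would divide p; it is not 1 since Z is
   proper, so it would be p. *)
have [g gG gp_nZ] : exists2 g, g \in G & g ^+ p \notin 'Z(G).
  apply/exists_inP; apply: contraT => /exists_inPn exp_p.
  have /(prime_nt_dvdP p_pr) exp_dvd : exponent (G / 'Z(G)) %| p.
    apply/exponentP=> _ /morphimP[x xN xG ->].
    by rewrite -morphX //= coset_id // -[_ \in _]negbK exp_p.
  case: exp_neq; apply: exp_dvd; rewrite -dvdn1 -trivg_exponent.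
  by rewrite -subG1 quotient_sub1.
have g_nZ : g \notin 'Z(G) by apply: contra gp_nZ; apply: groupX.
have le1 : #|'Z(G)| * #|'C_G[g]| <= #|'C_G[g ^+ p]|.
  apply: camina_pair_cent_bound; rewrite ?in_setD ?g_nZ ?subsetIl //.
  move=> x xG cgx; have [_ /centP cR] := setIP cgx.
  rewrite inE xG; apply/cent1P/commute_sym/commgP.
  rewrite commXg; last exact/commute_sym/cR.
  by apply/eqP/(camina_pair_center_expg camG).
(* The same bound, now at g^p and with [A] the whole of G. *)
have le2 : #|'Z(G)| * #|'C_G[g ^+ p]| <= #|G|.
  by apply: camina_pair_cent_bound; rewrite ?in_setD ?gp_nZ ?groupX.
have ltC : #|'Z(G)| < #|'C_G[g]|.
  apply/proper_card/properP; split; last first.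
    by exists g => //; rewrite inE gG cent1id.
  by rewrite setIS // -cent_set1 centS ?sub1set.
(* After multiplying by |Z|: |Z|^3 < |Z|^2 |C_G(g)| <= |Z| |C_G(g^p)| <= |G|. *)
have lt_sq : #|'Z(G)| ^ 2 < #|G : 'Z(G)|.
  rewrite -(ltn_pmul2l (cardG_gt0 'Z(G))) Lagrange //.
  apply: leq_trans le2; apply: leq_trans (leq_mul (leqnn _) le1).
  by rewrite -mulnn !ltn_pmul2l ?cardG_gt0.
(* Writing |Z| as the square root of |Z|^2 reduces the claim to [lt_sq]. *)
by rewrite -[ltLHS]sqrCK ?ler0n // ltr_sqrtC ?qualifE/= -?natrX ?ltr_nat ?ler0n.
Qed.
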